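(* For every positive integer $k$ and every integer $n$ the following identities hold: \[ \sum_{j = 0}^k \sum_{i = 0}^j \binom kj\binom ji t^{k - j} s^{k + j - i} r^i w_{n - 3k + j + i} = s^k w_n, \] \[ \sum_{j = 0}^k \sum_{i = 0}^j \binom kj\binom ji s^{k - j} t^{k + j - i} r^i w_{n - 2k - j + 2i} = t^k w_n, \] \[ \sum_{j = 0}^k \sum_{i = 0}^j \binom kj\binom ji r^{k - j} t^{k + j - i} s^i w_{n - k - 2j + i} = t^k w_n, \] \[ \sum_{j = 0}^k \sum_{i = 0}^j ( - 1)^i \binom kj\binom ji t^{k - j} s^{j - i}w_{n - 2k + j + 2i} = ( - r)^k w_n, \] \[ \sum_{j = 0}^k \sum_{i = 0}^j ( - 1)^i \binom kj\binom ji t^{k - j} r^{j - i} w_{n - k + 2j + i} = ( - s)^k w_n, \] \[ \sum_{j = 0}^k \sum_{i = 0}^j ( - 1)^i \binom kj\binom ji s^{k - j} r^{j - i} w_{n + k + j + i} = ( - t)^k w_n. \]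
   Context: Let $a,b,c,r,s,t$ be complex numbers with $t\neq 0$. The sequence $(w_n)=(w_n(a,b,c;r,s,t))$ is defined by $w_0=a$, $w_1=b$, $w_2=c$ and $w_n=rw_{n-1}+sw_{n-2}+tw_{n-3}$ for $n\ge 3$, and is extended to negative indices by $w_{-n}=(w_{-(n-3)}-rw_{-(n-2)}-sw_{-(n-1)})/t$, so that the recurrence holds for all integer indices. The convention $0^0=1$ is used. *)

(* Defs.v *)
From HB Require Import structures.
From mathcomp Require Import all_boot all_order all_algebra.
From mathcomp Require Import reals.
From mathcomp Require Import complex.
From mathcomp Require Import zify ring.

Set Implicit Arguments.
Unset Strict Implicit.
Unset Printing Implicit Defensive.

Import Order.TTheory GRing.Theory Num.Theory.
Local Open Scope ring_scope.

Section Sequence.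
Variables (F : fieldType) (a b c r s t : F).

Fixpoint w_fwd (m : nat) : F :=
  match m with
  | 0 => a
  | S m1 =>
    match m1 with
    | 0 => b
    | S m2 =>
      match m2 with
      | 0 => c
      | S m3 => r * w_fwd m1 + s * w_fwd m2 + t * w_fwd m3
      end
    end
  end.

(* [w_bwd m] is w_(2 - m): the backward recursion
   w_(-n) = (w_(-(n-3)) - r w_(-(n-2)) - s w_(-(n-1))) / t, n >= 1,
   started from w_2, w_1, w_0. *)
Fixpoint w_bwd (m : nat) : F :=
  match m with
  | 0 => c
  | S m1 =>
    match m1 with
    | 0 => b
    | S m2 =>
      match m2 with
      | 0 => a
      | S m3 => (w_bwd m3 - r * w_bwd m2 - s * w_bwd m1) / t
      end
    end
  end.

(* [Negz m] is -(m + 1) = 2 - (m + 3). *)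
Definition w (n : int) : F :=
  match n with
  | Posz m => w_fwd m
  | Negz m => w_bwd m.+3
  end.

Lemma w_init : [/\ w 0 = a, w 1 = b & w 2 = c].
Proof. by []. Qed.

Lemma w_fwdE (n : int) : 3 <= n ->
  w n = r * w (n - 1) + s * w (n - 2) + t * w (n - 3).
Proof.
case: n => [[|[|[|m]]]|m] // _.
have -> : Posz m.+3 - 1 = Posz m.+2 by lia.
have -> : Posz m.+3 - 2 = Posz m.+1 by lia.
by have -> : Posz m.+3 - 3 = Posz m by lia.
Qed.

Lemma w_bwdE (n : nat) : (0 < n)%N ->
  w (- n%:Z) =
  (w (- (n%:Z - 3)) - r * w (- (n%:Z - 2)) - s * w (- (n%:Z - 1))) / t.
Proof. by case: n => [|[|[|[|m]]]]. Qed.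

Lemma w_rec (n : int) : t != 0 ->
  w n = r * w (n - 1) + s * w (n - 2) + t * w (n - 3).
Proof.
move=> t0; case: (lerP 3 n) => [/w_fwdE //|n3].
have [m m0 nE] : exists2 m : nat, (0 < m)%N & n = 3 - m%:Z.
  by exists (absz (3 - n)); lia.
have := w_bwdE m0.
have -> : - (m%:Z - 3) = n by lia.
have -> : - (m%:Z - 2) = n - 1 by lia.
have -> : - (m%:Z - 1) = n - 2 by lia.
have -> : - m%:Z = n - 3 by lia.
by move=> ->; field.
Qed.

End Sequence.

(* Main.v *)
Require Import Defs.
From mathcomp Require Import all_boot all_order all_algebra.
From mathcomp Require Import reals.
From mathcomp Require Import complex.
From mathcomp Require Import zify ring.

(* Each case k = 1 is the recurrence, multiplied by a constant or shifted, hence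
   of the form P(E) w = q w for a trinomial P in the shift operator E; the
   identities expand P(E)^k w = q^k w by applying the binomial theorem twice. *)

Import GRing.Theory.
Local Open Scope ring_scope.

(** Pascal's rule with an arbitrary [G p j] in place of the monomial $x^p y^j$. This generality lets
    [G] itself be a binomial sum, so that the rule can be nested. *)
Lemma binomial_sumS {V : nmodType} (G : nat -> nat -> V) (k : nat) :
  \sum_(0 <= j < k.+2) G (k.+1 - j)%N j *+ 'C(k.+1, j) =
  \sum_(0 <= j < k.+1) (G (k - j).+1 j + G (k - j)%N j.+1) *+ 'C(k, j).
Proof.
rewrite big_nat_recl // bin0.
under eq_bigr do rewrite binS mulrnDr subSS.
under [RHS]eq_bigr do rewrite mulrnDl.
rewrite !big_split /= addrA; congr (_ + _).
(* On the left the top term carries ['C(k, k.+1)], which is 0; on the right the term [j = 0] matches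
   the one isolated at the start. *)
rewrite [RHS]big_nat_recl // big_nat_recr //= bin_small // mulr0n addr0 bin0 !subn0.
congr (_ + _); apply: eq_big_nat => i /andP[_ ltik].
by rewrite -subSn // subSS.
Qed.

(** Pascal's rule is used twice: on the outer sum, whose [G] is the whole inner sum, and then on the
    inner sum of length [j.+2] that this produces. *)
Lemma trinomial_sumS {V : nmodType} (H : nat -> nat -> nat -> V) (k : nat) :
  \sum_(0 <= j < k.+2)
    (\sum_(0 <= i < j.+1) H (k.+1 - j)%N (j - i)%N i *+ 'C(j, i)) *+ 'C(k.+1, j) =
  \sum_(0 <= j < k.+1)
    (\sum_(0 <= i < j.+1)
       (H (k - j).+1 (j - i)%N i
        + (H (k - j)%N (j - i).+1 i + H (k - j)%N (j - i)%N i.+1)) *+ 'C(j, i))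
    *+ 'C(k, j).
Proof.
rewrite (binomial_sumS
  (fun p j => \sum_(0 <= i < j.+1) H p (j - i)%N i *+ 'C(j, i))).
apply: eq_bigr => j _; congr (_ *+ _).
rewrite (binomial_sumS (H (k - j)%N)) -big_split /=.
by apply: eq_bigr => i _; rewrite -mulrnDl.
Qed.

(** Induction on [k]: raising the exponent of [x], [y] or [z] by one shifts the index by [d], [e] or
    [m], so the three neighbours of each term [H u v l] add up to [q * H u v l] by the
    hypothesis. *)
Lemma shift_trinomial {F : comPzRingType} (f : int -> F) (x y z q : F)
    (d e m : int) :
  (forall n, x * f (n + d) + y * f (n + e) + z * f (n + m) = q * f n) ->
  forall (k : nat) (n : int),
  \sum_(0 <= j < k.+1) \sum_(0 <= i < j.+1)
    'C(k, j)%:R * 'C(j, i)%:R * x ^+ (k - j) * y ^+ (j - i) * z ^+ i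
    * f (n + d * (k - j)%N%:Z + e * (j - i)%N%:Z + m * i%:Z) = q ^+ k * f n.
Proof.
move=> rec k n.
pose H (u v l : nat) : F :=
  x ^+ u * y ^+ v * z ^+ l * f (n + d * u%:Z + e * v%:Z + m * l%:Z).
transitivity (\sum_(0 <= j < k.+1)
    (\sum_(0 <= i < j.+1) H (k - j)%N (j - i)%N i *+ 'C(j, i)) *+ 'C(k, j)).
  apply: eq_bigr => j _; rewrite -sumrMnl; apply: eq_bigr => i _.
  by rewrite -[RHS]mulr_natl -[X in _ = _ * X]mulr_natl /H !mulrA.
elim: k => [|k IHk].
  by rewrite !big_nat1 /H !bin0 !mulr1n !subn0 !expr0 !mul1r !mulr0 !addr0.
rewrite trinomial_sumS exprS -mulrA -IHk mulr_sumr.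
apply: eq_bigr => j _; rewrite mulrnAr mulr_sumr; congr (_ *+ _).
apply: eq_bigr => i _; rewrite mulrnAr; congr (_ *+ _); rewrite /H.
move: (k - j)%N (j - i)%N => u v.
(* Bringing [q] next to [f] lets the hypothesis, read backwards, split the term into its three
   shifts. *)
rewrite mulrCA -rec.
set N := n + d * u%:Z + e * v%:Z + m * i%:Z.
have -> : n + d * u.+1%:Z + e * v%:Z + m * i%:Z = N + d by rewrite /N; lia.
have -> : n + d * u%:Z + e * v.+1%:Z + m * i%:Z = N + e by rewrite /N; lia.
have -> : n + d * u%:Z + e * v%:Z + m * i.+1%:Z = N + m by rewrite /N; lia.
by rewrite !exprS; ring.
Qed.

Theorem theorem15 (R : realType) (a b c r s t : R[i]) (ht : t != 0)
    (k : nat) (hk : (0 < k)%N) (n : int) :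
  (\sum_(0 <= j < k.+1) \sum_(0 <= i < j.+1)
      'C(k, j)%:R * 'C(j, i)%:R * t ^+ (k - j) * s ^+ (k + j - i) * r ^+ i
      * w a b c r s t (n - 3 * k%:Z + j%:Z + i%:Z)
    = s ^+ k * w a b c r s t n)
  /\ (\sum_(0 <= j < k.+1) \sum_(0 <= i < j.+1)
      'C(k, j)%:R * 'C(j, i)%:R * s ^+ (k - j) * t ^+ (k + j - i) * r ^+ i
      * w a b c r s t (n - 2 * k%:Z - j%:Z + 2 * i%:Z)
    = t ^+ k * w a b c r s t n)
  /\ (\sum_(0 <= j < k.+1) \sum_(0 <= i < j.+1)
      'C(k, j)%:R * 'C(j, i)%:R * r ^+ (k - j) * t ^+ (k + j - i) * s ^+ i
      * w a b c r s t (n - k%:Z - 2 * j%:Z + i%:Z)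
    = t ^+ k * w a b c r s t n)
  /\ (\sum_(0 <= j < k.+1) \sum_(0 <= i < j.+1)
      (-1) ^+ i * 'C(k, j)%:R * 'C(j, i)%:R * t ^+ (k - j) * s ^+ (j - i)
      * w a b c r s t (n - 2 * k%:Z + j%:Z + 2 * i%:Z)
    = (- r) ^+ k * w a b c r s t n)
  /\ (\sum_(0 <= j < k.+1) \sum_(0 <= i < j.+1)
      (-1) ^+ i * 'C(k, j)%:R * 'C(j, i)%:R * t ^+ (k - j) * r ^+ (j - i)
      * w a b c r s t (n - k%:Z + 2 * j%:Z + i%:Z)
    = (- s) ^+ k * w a b c r s t n)
  /\ (\sum_(0 <= j < k.+1) \sum_(0 <= i < j.+1)
      (-1) ^+ i * 'C(k, j)%:R * 'C(j, i)%:R * s ^+ (k - j) * r ^+ (j - i)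
      * w a b c r s t (n + k%:Z + j%:Z + i%:Z)
    = (- t) ^+ k * w a b c r s t n).
Proof.
have rec := fun l => w_rec a b c r s l ht.
move: (w a b c r s t) rec => f rec.
(* In the first three identities the recurrence is multiplied by [s] or [t], which then occurs in
   all three coefficients, squared in the second: $k + j - i = (k - j) + 2(j - i) + i$. *)
have exprkji (x : R[i]) j i : (i < j.+1)%N -> (j < k.+1)%N ->
    x ^+ (k + j - i) = x ^+ (k - j) * x ^+ (j - i) * x ^+ (j - i) * x ^+ i.
  by move=> *; rewrite -!exprD; congr (_ ^+ _); lia.
(* The shifts by 1, 2 and 3 put [f l] beside [r], [s] and [t] respectively; solving for that term
   gives the last three identities, where [z = -1] yields the alternating sign. *)
have rec1 l : f (l + 1) = r * f l + s * f (l - 1) + t * f (l - 2).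
  by rewrite rec; congr (_ * f _ + _ * f _ + _ * f _); lia.
have rec2 l : f (l + 2) = r * f (l + 1) + s * f l + t * f (l - 1).
  by rewrite rec; congr (_ * f _ + _ * f _ + _ * f _); lia.
have rec3 l : f (l + 3) = r * f (l + 2) + s * f (l + 1) + t * f l.
  by rewrite rec; congr (_ * f _ + _ * f _ + _ * f _); lia.
do 5?split;
  [ rewrite -(shift_trinomial f (t * s) (s * s) (s * r) s (-3) (-2) (-1));
      last by move=> l; rewrite [in RHS]rec; ring
  | rewrite -(shift_trinomial f (s * t) (t * t) (t * r) t (-2) (-3) (-1));
      last by move=> l; rewrite [in RHS]rec; ring
  | rewrite -(shift_trinomial f (r * t) (t * t) (t * s) t (-1) (-3) (-2));
      last by move=> l; rewrite [in RHS]rec; ring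
  | rewrite -(shift_trinomial f t s (-1) (- r) (-2) (-1) 1);
      last by move=> l; rewrite rec1; ring
  | rewrite -(shift_trinomial f t r (-1) (- s) (-1) 1 2);
      last by move=> l; rewrite rec2; ring
  | rewrite -(shift_trinomial f s r (-1) (- t) 1 2 3);
      last by move=> l; rewrite rec3; ring ];
  (* The bounds [i <= j <= k] are kept because the natural subtractions [k - j] and [j - i] agree
     with the integer ones only under them. *)
  apply: eq_big_nat => j /andP[_ jk]; apply: eq_big_nat => i /andP[_ ij];
  (congr (_ * f _); last by lia);
  by rewrite ?exprkji // ?exprMn; ring.
Qed.
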